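(* Let $\mathcal{G}$ be a $3$-player $\mathsf{XOR}$ game given by a distribution $\mu$ on $\Sigma\times\Gamma\times\Phi$ (finite alphabets) and a target function $t:\mathsf{supp}(\mu)\to\mathcal{A}$ with $\mathcal{A}$ a finite Abelian group. If $\mathsf{val}(\mathcal{G})<1$ and $\mu$ has no $\mathbb{Z}$-embeddings, then there is a constant $c=c(\mathcal{G},\mu)>0$ such that $\mathsf{val}(\mathcal{G}^{\otimes n})\le 2^{-cn}$ for all $n\ge 1$.
   Context: In the game $\mathcal{G}$ a verifier samples $(x,y,z)\sim\mu$, sends $x,y,z$ to three players, who answer $f(x),g(y),h(z)\in\mathcal{A}$; the verifier accepts iff $f(x)+g(y)+h(z)=t(x,y,z)$. $\mathsf{val}(\mathcal{G})$ is the maximum acceptance probability over all strategies. The $n$-fold repetition $\mathcal{G}^{\otimes n}$ has value $\mathsf{val}(\mathcal{G}^{\otimes n})=\max_{f:\Sigma^n\to\mathcal{A}^n,\,g:\Gamma^n\to\mathcal{A}^n,\,h:\Phi^n\to\mathcal{A}^n}\Pr_{(x,y,z)\sim\mu^{\otimes n}}[f(x)_i+g(y)_i+h(z)_i=t(x_i,y_i,z_i)\ \forall i\in[n]]$. An embedding of $\mu$ into an Abelian group $A$ is a triple of maps $\mathsf{a}:\Sigma\to A$, $\mathsf{b}:\Gamma\to A$, $\mathsf{c}:\Phi\to A$ with $\mathsf{a}(x)+\mathsf{b}(y)+\mathsf{c}(z)=0$ for all $(x,y,z)\in\mathsf{supp}(\mu)$. $\mu$ has no $\mathbb{Z}$-embeddings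 if every embedding of $\mu$ into $(\mathbb{Z},+)$ consists of constant maps. *)

(* Defs.v *)
From HB Require Import structures.
From mathcomp Require Import all_boot all_order all_algebra.
From mathcomp Require Import reals exp.
Set Implicit Arguments. Unset Strict Implicit. Unset Printing Implicit Defensive.
Import Order.TTheory GRing.Theory Num.Theory.
Local Open Scope ring_scope.

Section XorGame.
Variables (R : realType) (Sigma Gamma Phi : finType) (A : finZmodType).

Definition is_distr (mu : Sigma -> Gamma -> Phi -> R) : Prop :=
  (forall x y z, 0 <= mu x y z) /\
  \sum_(x : Sigma) \sum_(y : Gamma) \sum_(z : Phi) mu x y z = 1.

Definition game_val (mu : Sigma -> Gamma -> Phi -> R) (t : Sigma -> Gamma -> Phi -> A) : R :=
  \big[Num.max/0]_(f : {ffun Sigma -> A}) \big[Num.max/0]_(g : {ffun Gamma -> A})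
   \big[Num.max/0]_(h : {ffun Phi -> A})
    \sum_(x : Sigma) \sum_(y : Gamma) \sum_(z : Phi)
      mu x y z * (f x + g y + h z == t x y z)%:R.

Definition game_val_rep (mu : Sigma -> Gamma -> Phi -> R) (t : Sigma -> Gamma -> Phi -> A)
    (n : nat) : R :=
  \big[Num.max/0]_(f : {ffun {ffun 'I_n -> Sigma} -> {ffun 'I_n -> A}})
  \big[Num.max/0]_(g : {ffun {ffun 'I_n -> Gamma} -> {ffun 'I_n -> A}})
  \big[Num.max/0]_(h : {ffun {ffun 'I_n -> Phi} -> {ffun 'I_n -> A}})
    \sum_(x : {ffun 'I_n -> Sigma}) \sum_(y : {ffun 'I_n -> Gamma})
    \sum_(z : {ffun 'I_n -> Phi})
      (\prod_(i < n) mu (x i) (y i) (z i)) *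
      [forall i : 'I_n, f x i + g y i + h z i == t (x i) (y i) (z i)]%:R.

Definition is_embedding (B : zmodType) (mu : Sigma -> Gamma -> Phi -> R)
    (a : Sigma -> B) (b : Gamma -> B) (c : Phi -> B) : Prop :=
  forall x y z, mu x y z != 0 -> a x + b y + c z = 0.

Definition no_Z_embeddings (mu : Sigma -> Gamma -> Phi -> R) : Prop :=
  forall (a : Sigma -> int) (b : Gamma -> int) (c : Phi -> int),
    is_embedding mu a b c ->
    [/\ forall x x', a x = a x', forall y y', b y = b y' & forall z z', c z = c z'].

End XorGame.

(* Main.v *)
Require Import Defs.
From HB Require Import structures.
From mathcomp Require Import all_boot all_order all_algebra.
From mathcomp Require Import ring boolp reals exp.
Import Order.TTheory GRing.Theory Num.Theory.
Local Open Scope ring_scope.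
Set Implicit Arguments. Unset Strict Implicit. Unset Printing Implicit Defensive.

(** Every step is an application of Cauchy-Schwarz in the form: if an event has probability
    e under a product law, then K samples that are independent conditionally on an observable
    all lie in the event with probability at least e^(2^K).  Since the observable is sampled
    coordinatewise, the new law is again a product law, and equality of the observable holds
    between whole question vectors, so that strategies evaluated at it cancel.

    Starting from the winning event, resampling produces "gadgets": laws on letters (x, y, z),
    a visible part u and an element a of A such that f(X) + g(Y) + h(Z) = phi(U) + a with
    probability polynomial in the success probability, where all letters (x, y, z) occur, and
    all (x, y, z) in supp(mu) occur with one common value of u and with a = t(x, y, z).  Only the
    pairwise connectivity of supp(mu), a consequence of the absence of Z-embeddings, is needed.
    Resampling the letters of a gadget one type at a time then gives vectors X_x, Y_y, Z_z, one
    for each letter, with a gadget on each triple (X_x, Y_y, Z_z).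

    If val(G) < 1, the Smith normal form of the system f(x) + g(y) + h(z) = t(x, y, z) provides an
    integer d and weights lam on supp(mu), with lam-mass divisible by d at every letter, such that
    the sum of lam * t is not in d A.  Summing the gadget equations with weights lam, the letters
    contribute an element of d A; comparing two samples with the same visible parts shows that the
    lam-weighted sums of a agree modulo d A.  The letter vectors equal to (x, y, z) at the triple
    (x, y, z), and those constantly equal to a fixed element of supp(mu), have the same visible
    parts but violate this, so a good pair of samples avoids an outcome of positive probability in
    each of the n coordinates. *)

(** * Conditional resampling of product laws *)

Section ProductMeasure.
Variable R : realType.

Definition prob n (T : finType) (p : T -> R) (E : {ffun 'I_n -> T} -> Prop) : R :=
  \sum_(w : {ffun 'I_n -> T}) (\prod_i p (w i)) * `[< E w >]%:R.

Definition push (T T' : finType) (F : T -> T') (p : T -> R) (b : T') : R :=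
  \sum_(a | F a == b) p a.

(** At a value [v] of mass 0, division by zero makes this the zero function and not a law; such [v]
    carry no weight in [copies]. *)
Definition cond (T U : finType) (u : T -> U) (p : T -> R) (v : U) (a : T) : R :=
  p a * (u a == v)%:R / push u p v.

(* Law of [K]-many samples that are independent conditionally on a common value of [u]. *)
Definition copies (K T U : finType) (u : T -> U) (p : T -> R) (c : {ffun K -> T}) : R :=
  \sum_v push u p v * \prod_j cond u p v (c j).

Lemma prob_le n (T : finType) (p : T -> R) (E E' : {ffun 'I_n -> T} -> Prop) :
  (forall a, 0 <= p a) ->
  (forall w : {ffun 'I_n -> T}, (forall i, 0 < p (w i)) -> E w -> E' w) ->
  prob p E <= prob p E'.
Proof.
move=> p0 sub; apply: ler_sum => w _.
have [pw|] := boolP [forall i, 0 < p (w i)].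
  apply: ler_wpM2l; first exact: prodr_ge0.
  rewrite ler_nat; case: (asboolP (E w)) => // Ew.
  by rewrite asboolT //; apply: sub Ew; apply/forallP.
rewrite negb_forall => /existsP[i]; rewrite -leNgt => pi.
have {}pi : p (w i) = 0 by apply/eqP; rewrite eq_le pi p0.
by rewrite (bigD1 i) //= pi !mul0r.
Qed.

Lemma push_ge0 (T T' : finType) (F : T -> T') (p : T -> R) b :
  (forall a, 0 <= p a) -> 0 <= push F p b.
Proof. by move=> p0; apply: sumr_ge0. Qed.

Lemma push_le (T T' : finType) (F : T -> T') (p : T -> R) a :
  (forall a, 0 <= p a) -> p a <= push F p (F a).
Proof. by move=> p0; rewrite /push (bigD1 a) //= lerDl sumr_ge0. Qed.

Lemma sum_push (T T' : finType) (F : T -> T') (p : T -> R) :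
  \sum_b push F p b = \sum_a p a.
Proof. by rewrite [RHS](partition_big F predT). Qed.

Lemma prob_push n (T T' : finType) (F : T -> T') (p : T -> R)
    (E : {ffun 'I_n -> T'} -> Prop) :
  prob (push F p) E = prob p (fun w : {ffun 'I_n -> T} => E [ffun i => F (w i)]).
Proof.
rewrite /prob [RHS](partition_big (fun w : {ffun 'I_n -> T} => [ffun i => F (w i)]) predT) //=.
apply: eq_bigr => w _; rewrite bigA_distr_big_dep mulr_suml.
apply/esym/eq_big => [v|v /eqP->//].
rewrite -[RHS]/(v \in family _); apply/eqP/familyP => [<- i|h]; first by rewrite unfold_in ffunE.
by apply/ffunP => i; rewrite ffunE; apply/eqP; have := h i; rewrite unfold_in.
Qed.

Lemma cond_ge0 (T U : finType) (u : T -> U) (p : T -> R) v a :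
  (forall a, 0 <= p a) -> 0 <= cond u p v a.
Proof. by move=> p0; rewrite /cond !mulr_ge0 ?invr_ge0 ?ler0n ?push_ge0. Qed.

Lemma sum_cond (T U : finType) (u : T -> U) (p : T -> R) v :
  \sum_a cond u p v a = push u p v / push u p v.
Proof.
rewrite -mulr_suml; congr (_ / _); rewrite /push [RHS]big_mkcond /=.
by apply: eq_bigr => a _; case: (u a == v); rewrite ?mulr1 ?mulr0.
Qed.

Lemma sum_push_cond (T U : finType) (u : T -> U) (p : T -> R) a :
  (forall a, 0 <= p a) -> \sum_v push u p v * cond u p v a = p a.
Proof.
move=> p0; rewrite (bigD1 (u a)) //= big1 ?addr0 => [|v /negbTE vu]; last first.
  by rewrite /cond eq_sym vu mulr0 mul0r mulr0.
rewrite /cond eqxx mulr1 mulrC.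
have [P0|P0] := eqVneq (push u p (u a)) 0; last by rewrite divfK.
rewrite P0 mulr0; apply/eqP; rewrite eq_le p0 /=.
by rewrite -P0 push_le.
Qed.

Lemma copies_ge0 (K T U : finType) (u : T -> U) (p : T -> R) (c : {ffun K -> T}) :
  (forall a, 0 <= p a) -> 0 <= copies u p c.
Proof.
move=> p0; apply: sumr_ge0 => v _; rewrite mulr_ge0 ?push_ge0 // prodr_ge0 // => j _.
exact: cond_ge0.
Qed.

Lemma sum_copies (K T U : finType) (u : T -> U) (p : T -> R) :
  \sum_(c : {ffun K -> T}) copies u p c = \sum_a p a.
Proof.
rewrite exchange_big /= -(sum_push u); apply: eq_bigr => v _.
rewrite -mulr_sumr -(bigA_distr_bigA (fun (_ : K) a => cond u p v a)) /=.
rewrite sum_cond.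
have [->|P0] := eqVneq (push u p v) 0; first by rewrite mul0r.
by rewrite divff // big1 ?mulr1.
Qed.

Lemma copies_gt0 (K T U : finType) (u : T -> U) (p : T -> R) (c : {ffun K -> T}) (k : K) :
  (forall a, 0 <= p a) -> (forall j, 0 < p (c j)) ->
  (forall j, u (c j) = u (c k)) -> 0 < copies u p c.
Proof.
move=> p0 pc uc.
have P0 : 0 < push u p (u (c k)) by apply: lt_le_trans (push_le u (c k) p0).
rewrite /copies (bigD1 (u (c k))) //=; apply: ltr_wpDr.
  apply: sumr_ge0 => v _; rewrite mulr_ge0 ?push_ge0 // prodr_ge0 // => j _.
  exact: cond_ge0.
apply: mulr_gt0 => //; apply: prodr_gt0 => j _.
by rewrite /cond uc eqxx mulr1 divr_gt0.
Qed.

Lemma copies_gt0_inv (K T U : finType) (u : T -> U) (p : T -> R) (c : {ffun K -> T}) :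
  (forall a, 0 <= p a) -> 0 < copies u p c ->
  forall j j', u (c j) = u (c j').
Proof.
move=> p0 cp.
have /existsP[v vP] : [exists v, push u p v * \prod_j cond u p v (c j) != 0].
  apply: contraT; rewrite negb_exists => /forallP h; move: cp.
  by rewrite /copies big1 ?ltxx // => v _; apply/eqP; have := h v; rewrite negbK.
suff h j : u (c j) = v by move=> j j'; rewrite !h.
apply/eqP; apply: contraNT vP => ucv.
by rewrite (bigD1 j) //= /cond (negbTE ucv) mulr0 mul0r mul0r mulr0.
Qed.

(** Each squaring uses that a variance is nonnegative; iterating it produces the exponents that are
    powers of two. *)
Lemma jensen_pow2 (I : finType) (P r : I -> R) e :
  (forall i, 0 <= P i) -> \sum_i P i = 1 ->
  (\sum_i P i * r i) ^+ (2 ^ e) <= \sum_i P i * r i ^+ (2 ^ e).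
Proof.
move=> P0 P1; elim: e r => [|e IH] r; first by rewrite expn0.
rewrite expnS exprM; under [leRHS]eq_bigr do rewrite exprM.
apply: le_trans (IH (fun i => r i ^+ 2)); apply: lerXn2r; rewrite ?nnegrE ?sqr_ge0 //.
  by apply: sumr_ge0 => i _; rewrite mulr_ge0 ?sqr_ge0.
move mE: (\sum_i P i * r i) => m.
have : 0 <= \sum_i P i * (r i - m) ^+ 2.
  by apply: sumr_ge0 => i _; rewrite mulr_ge0 ?sqr_ge0.
have -> : \sum_i P i * (r i - m) ^+ 2 =
    \sum_i P i * r i ^+ 2 - 2 * m * \sum_i P i * r i + m ^+ 2 * \sum_i P i.
  by rewrite !mulr_sumr -sumrB -big_split /=; apply: eq_bigr => i _; ring.
by rewrite P1 mE -[_ <= \sum_i _]subr_ge0; congr (_ <= _); ring.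
Qed.

(** Given the observable vector [V], the samples are independent, so all of them lie in [E] with
    probability [r V ^+ #|K|], where [r V] is the conditional probability of [E]. Jensen bounds the
    average over [V]. *)
Lemma prob_copies n (K T U : finType) (u : T -> U) (p : T -> R)
    (E : {ffun 'I_n -> T} -> Prop) :
  (forall a, 0 <= p a) -> \sum_a p a = 1 ->
  prob p E ^+ (2 ^ #|K|) <=
  prob (copies u p) (fun c : {ffun 'I_n -> {ffun K -> T}} =>
                       forall j, E [ffun i => c i j]).
Proof.
move=> p0 p1.
pose P (V : {ffun 'I_n -> U}) := \prod_i push u p (V i).
pose q (V : {ffun 'I_n -> U}) (W : {ffun 'I_n -> T}) :=
  \prod_i cond u p (V i) (W i) * `[< E W >]%:R.
pose r V := \sum_W q V W.
have P0 V : 0 <= P V by apply: prodr_ge0 => i _; apply: push_ge0.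
have q0 V W : 0 <= q V W.
  by rewrite mulr_ge0 ?ler0n // prodr_ge0 // => i _; apply: cond_ge0.
have P1 : \sum_V P V = 1.
  rewrite -(bigA_distr_bigA (fun (_ : 'I_n) v => push u p v)) /= big1 // => i _.
  by rewrite sum_push.
have r0 V : 0 <= r V by apply: sumr_ge0.
have r1 V : r V <= 1.
  apply: (@le_trans _ _ (\sum_(W : {ffun 'I_n -> T}) \prod_i cond u p (V i) (W i))).
    apply: ler_sum => W _; rewrite /q ler_piMr ?lern1 ?leq_b1 //.
    by apply: prodr_ge0 => i _; apply: cond_ge0.
  rewrite -(bigA_distr_bigA (fun i a => cond u p (V i) a)) /=.
  apply: prodr_ile1 => i _; rewrite sum_cond.
  have [->|h] := eqVneq (push u p (V i)) 0; first by rewrite mul0r lexx ler01.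
  by rewrite divff // ler01 lexx.
have -> : prob p E = \sum_V P V * r V.
  under [RHS]eq_bigr do rewrite mulr_sumr.
  rewrite exchange_big /=; apply: eq_bigr => W _.
  under [RHS]eq_bigr do rewrite mulrA -big_split /=.
  rewrite -mulr_suml; congr (_ * _).
  rewrite -(bigA_distr_bigA (fun i v => push u p v * cond u p v (W i))) /=.
  by apply: eq_bigr => i _; rewrite sum_push_cond.
apply: le_trans (jensen_pow2 r _ P0 P1) _.
(* Jensen needs a power of two; since [r V <= 1], its exponent [2 ^ #|K|] may be lowered to
   [#|K|]. *)
apply: (@le_trans _ _ (\sum_V P V * r V ^+ #|K|)).
  apply: ler_sum => V _; apply: ler_wpM2l => //.
  by apply: ler_wiXn2l => //; apply: ltnW; apply: ltn_expl.
rewrite le_eqVlt; apply/orP; left; apply/eqP; rewrite /prob.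
pose tr (w : {ffun K -> {ffun 'I_n -> T}}) : {ffun 'I_n -> {ffun K -> T}} :=
  [ffun i => [ffun j => w j i]].
pose rt (w : {ffun 'I_n -> {ffun K -> T}}) : {ffun K -> {ffun 'I_n -> T}} :=
  [ffun i => [ffun j => w j i]].
have trK : cancel tr rt by move=> w; apply/ffunP => j; apply/ffunP => i; rewrite !ffunE.
have rtK : cancel rt tr by move=> w; apply/ffunP => j; apply/ffunP => i; rewrite !ffunE.
rewrite [RHS](reindex tr) /=; last by exists rt => ? _.
transitivity (\sum_V \sum_(w : {ffun K -> {ffun 'I_n -> T}}) P V * \prod_j q V (w j)).
  apply: eq_bigr => V _; rewrite -mulr_sumr; congr (_ * _).
  by rewrite -(bigA_distr_bigA (fun (_ : K) W => q V W)) /= prodr_const.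
rewrite exchange_big /=; apply: eq_bigr => w _.
rewrite /copies bigA_distr_bigA mulr_suml; apply: eq_bigr => V _.
rewrite /q !big_split /= -mulrA; congr (_ * _).
rewrite [in RHS]exchange_big /=; congr (_ * _).
  by apply: eq_bigr => j _; apply: eq_bigr => i _; rewrite !ffunE.
have wE j : [ffun i => tr w i j] = w j by apply/ffunP => i; rewrite !ffunE.
have [h|] := boolP [forall j, `[< E (w j) >]].
  rewrite big1 => [|j _]; last by rewrite (forallP h).
  by rewrite asboolT // => j; rewrite wE; apply/asboolP/(forallP h).
rewrite negb_forall => /existsP[j /negbTE h].
rewrite (bigD1 j) //= h mul0r asboolF // => /(_ j); rewrite wE => /asboolP.
by rewrite h.
Qed.

End ProductMeasure.

(** * Events of polynomially large probability *)

Definition mapv n (T T' : finType) (F : T -> T') (w : {ffun 'I_n -> T}) :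
  {ffun 'I_n -> T'} := [ffun i => F (w i)].

Definition map2v n (T1 T2 T' : finType) (F : T1 -> T2 -> T')
  (w1 : {ffun 'I_n -> T1}) (w2 : {ffun 'I_n -> T2}) : {ffun 'I_n -> T'} :=
  [ffun i => F (w1 i) (w2 i)].

Lemma mapv_comp n (T1 T2 T3 : finType) (F : T1 -> T2) (G : T2 -> T3) (w : {ffun 'I_n -> T1}) :
  mapv G (mapv F w) = mapv (G \o F) w.
Proof. by apply/ffunP => i; rewrite !ffunE. Qed.

Lemma mapv_id n (T1 : finType) (w : {ffun 'I_n -> T1}) : mapv id w = w.
Proof. by apply/ffunP => i; rewrite ffunE. Qed.

Lemma mapv_map2vl n (T1 T2 T3 T4 : finType) (F : T1 -> T2 -> T3) (G : T3 -> T4) (G1 : T1 -> T4)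
    (w1 : {ffun 'I_n -> T1}) (w2 : {ffun 'I_n -> T2}) :
  (forall a b, G (F a b) = G1 a) -> mapv G (map2v F w1 w2) = mapv G1 w1.
Proof. by move=> e; apply/ffunP => i; rewrite !ffunE e. Qed.

Lemma mapv_map2vr n (T1 T2 T3 T4 : finType) (F : T1 -> T2 -> T3) (G : T3 -> T4) (G1 : T2 -> T4)
    (w1 : {ffun 'I_n -> T1}) (w2 : {ffun 'I_n -> T2}) :
  (forall a b, G (F a b) = G1 b) -> mapv G (map2v F w1 w2) = mapv G1 w2.
Proof. by move=> e; apply/ffunP => i; rewrite !ffunE e. Qed.

Section Admissible.
Variables (R : realType) (St : nat -> Type) (val : forall n, St n -> R).
Hypothesis val01 : forall n (s : St n), 0 <= val s <= 1.

(* [Q] holds with probability polynomial in the success probability [val s] of the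
   strategies [s], for a product law whose coordinates charge every point of [D]. *)
Definition adm (T : finType) (D : T -> Prop)
    (Q : forall n, St n -> {ffun 'I_n -> T} -> Prop) : Prop :=
  exists p : T -> R,
    [/\ forall a, 0 <= p a, \sum_a p a = 1, forall a, D a -> 0 < p a &
        exists k, forall n (s : St n), val s ^+ k <= prob p (Q n s)].

(** The exponent grows by the factor [2 ^ #|K|], which does not depend on [n]. Tuples of points of
    [D] with a common value of [u] have positive mass under [copies], which gives the points of
    [D']. *)
Lemma adm_pow (K T U T' : finType) (u : T -> U) (F : {ffun K -> T} -> T')
    (D : T -> Prop) (Q : forall n, St n -> {ffun 'I_n -> T} -> Prop)
    (D' : T' -> Prop) (Q' : forall n, St n -> {ffun 'I_n -> T'} -> Prop) :
  (0 < #|K|)%N -> adm D Q ->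
  (forall b, D' b -> exists c : {ffun K -> T},
     [/\ F c = b, forall j, D (c j) & forall j j', u (c j) = u (c j')]) ->
  (forall n (s : St n) (c : K -> {ffun 'I_n -> T}), (forall j, Q n s (c j)) ->
     (forall j j', mapv u (c j) = mapv u (c j')) ->
     Q' n s [ffun i => F [ffun j => c j i]]) ->
  adm D' Q'.
Proof.
move=> /card_gt0P[k0 _] [p [p0 p1 pD [k pk]]] HD HQ.
have q0 (c : {ffun K -> T}) : 0 <= copies u p c by exact: copies_ge0.
exists (push F (copies (K := K) u p)); split.
- by move=> b; apply: push_ge0.
- by rewrite sum_push sum_copies.
- move=> b /HD[c [<- cD uc]]; apply: (lt_le_trans _ (push_le F c q0)).
  by apply: (copies_gt0 (k := k0)) => // j; apply: pD.
exists (k * 2 ^ #|K|)%N => n s; rewrite exprM prob_push.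
apply: (@le_trans _ _ (prob p (Q n s) ^+ (2 ^ #|K|))).
  apply: lerXn2r => //; rewrite nnegrE; first by rewrite exprn_ge0 //; case/andP: (val01 s).
  by apply: sumr_ge0 => w _; rewrite mulr_ge0 ?ler0n ?prodr_ge0.
apply: (le_trans (prob_copies K u (Q n s) p0 p1)); apply: prob_le => // w wp wQ.
have := HQ n s (fun j => [ffun i => w i j]) wQ.
have -> : [ffun i => F [ffun j => [ffun i' => w i' j] i]] = [ffun i => F (w i)].
  by apply/ffunP => i; rewrite !ffunE; congr F; apply/ffunP => j; rewrite !ffunE.
apply=> j j'; apply/ffunP => i; rewrite !ffunE.
by apply: copies_gt0_inv (wp i) _ _.
Qed.

Lemma adm_dbl (T U T' : finType) (u : T -> U) (F : T -> T -> T')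
    (D : T -> Prop) (Q : forall n, St n -> {ffun 'I_n -> T} -> Prop)
    (D' : T' -> Prop) (Q' : forall n, St n -> {ffun 'I_n -> T'} -> Prop) :
  adm D Q ->
  (forall b, D' b -> exists c1 c2, [/\ F c1 c2 = b, D c1, D c2 & u c1 = u c2]) ->
  (forall n (s : St n) c1 c2, Q n s c1 -> Q n s c2 -> mapv u c1 = mapv u c2 ->
     Q' n s (map2v F c1 c2)) ->
  adm D' Q'.
Proof.
move=> Dadm HD HQ.
apply: (adm_pow (K := bool) (u := u) (F := fun c => F (c true) (c false))) Dadm _ _.
- by rewrite card_bool.
- move=> b /HD[c1 [c2 [Fb D1 D2 u12]]]; exists [ffun j => if j then c1 else c2].
  by split; rewrite ?ffunE //; [case|do 2!case]; rewrite !ffunE.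
- move=> n s c Qc uc; have := HQ n s _ _ (Qc true) (Qc false) (uc _ _).
  by congr Q'; apply/ffunP => i; rewrite !ffunE.
Qed.

(** Doubling over the identity observable makes both samples equal. *)
Lemma adm_map (T T' : finType) (F : T -> T')
    (D : T -> Prop) (Q : forall n, St n -> {ffun 'I_n -> T} -> Prop)
    (D' : T' -> Prop) (Q' : forall n, St n -> {ffun 'I_n -> T'} -> Prop) :
  adm D Q ->
  (forall b, D' b -> exists2 c, F c = b & D c) ->
  (forall n (s : St n) c, Q n s c -> Q' n s (mapv F c)) ->
  adm D' Q'.
Proof.
move=> Dadm HD HQ; apply: (adm_dbl (u := id) (F := fun a _ => F a)) Dadm _ _.
  by move=> b /HD[c Fc Dc]; exists c, c.
move=> n s c1 c2 Q1 _ _; have := HQ n s _ Q1.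
by congr Q'; apply/ffunP => i; rewrite !ffunE.
Qed.

(** The middle component is the observable: all samples share it, while the outer components are
    resampled once for each index in [K]. *)
Lemma adm_blowup (K L M V : finType) (D : L * M * V -> Prop)
    (Q : forall n, St n -> {ffun 'I_n -> L * M * V} -> Prop) :
  (0 < #|K|)%N -> adm D Q ->
  adm (fun b : {ffun K -> L} * M * {ffun K -> V} =>
         forall j, D (b.1.1 j, b.1.2, b.2 j))
      (fun n s w => forall j, Q n s
         (mapv (fun b : {ffun K -> L} * M * {ffun K -> V} => (b.1.1 j, b.1.2, b.2 j)) w)).
Proof.
move=> K0 Dadm; have /card_gt0P[k0 _] := K0.
apply: (adm_pow (K := K) (u := fun c : L * M * V => c.1.2)
  (F := fun c : {ffun K -> L * M * V} =>
          ([ffun j => (c j).1.1], (c k0).1.2, [ffun j => (c j).2]))) K0 Dadm _ _.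
  move=> [[l m] v] /= Dj; exists [ffun j => (l j, m, v j)]; split.
  - by congr (_, _, _); [apply/ffunP => j|..|apply/ffunP => j]; rewrite !ffunE.
  - by move=> j; rewrite ffunE.
  - by move=> j j'; rewrite !ffunE.
move=> n s c Qc uc j; have := Qc j; congr Q; apply/ffunP => i; rewrite !ffunE /=.
have := congr1 (fun w : {ffun 'I_n -> M} => w i) (uc j k0); rewrite !ffunE => <-.
by case: (c j i) => [[]].
Qed.

End Admissible.

(** * Arms *)

Lemma cancel_middle (V : zmodType) (a b c d e : V) :
  a - d = (e - c) + ((a + b + c) - (d + b + e)).
Proof.
rewrite (addrAC a) [d + b]addrC -(addrA b) addrKA opprD [X in _ = _ + X]addrACA.
by rewrite [RHS]addrC -addrA -[e - c]opprB subrr addr0.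
Qed.
Lemma cancel_l (V : zmodType) (p a b c d : V) : p = c + a -> p = d + b -> c - d = b - a.
Proof. by move=> -> e; rewrite -[c](addrK a) e addrAC [d + b]addrC addrK. Qed.

Fixpoint reach (X : Type) (r : X -> X -> Prop) (j : nat) (a b : X) : Prop :=
  if j is j'.+1 then exists2 c, reach r j' a c & r c b else a = b.

Definition share (T X V : Type) (D : T -> Prop) (x : T -> X) (v : T -> V) (a b : X) : Prop :=
  exists w1 w2, [/\ D w1, D w2, x w1 = a, x w2 = b & v w1 = v w2].

Section Arm.
Variables (R : realType) (St : nat -> Type) (val : forall n, St n -> R).
Hypothesis val01 : forall n (s : St n), 0 <= val s <= 1.
Variables (A : finZmodType) (X Y Z T : finType).
Variables (f : forall n, St n -> {ffun 'I_n -> X} -> {ffun 'I_n -> A}).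
Variables (g : forall n, St n -> {ffun 'I_n -> Y} -> {ffun 'I_n -> A}).
Variables (h : forall n, St n -> {ffun 'I_n -> Z} -> {ffun 'I_n -> A}).
Variables (x : T -> X) (y : T -> Y) (z : T -> Z) (t : T -> A).
Variables (D : T -> Prop) (Q : forall n, St n -> {ffun 'I_n -> T} -> Prop).
Hypothesis DQ : adm val D Q.
Hypothesis HQ : forall n (s : St n) w, Q s w ->
  f s (mapv x w) + g s (mapv y w) + h s (mapv z w) = mapv t w.

(* An arm joins a new letter to the letter [x] of the sample of the base [T] that it carries. *)
Definition arm_event (V : finType)
    (phi : forall n, St n -> {ffun 'I_n -> V} -> {ffun 'I_n -> A})
    n (s : St n) (w : {ffun 'I_n -> X * T * V * A}) : Prop :=
  Q s (mapv (fun a => a.1.1.2) w) /\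
  f s (mapv (fun a => a.1.1.1) w) - f s (mapv (fun a => x a.1.1.2) w) =
  phi n s (mapv (fun a => a.1.2) w) + mapv (fun a => a.2) w.

Definition diff_fun n (s : St n) (v : {ffun 'I_n -> X * X}) : {ffun 'I_n -> A} :=
  f s (mapv fst v) - f s (mapv snd v).

Lemma mapv_map2vB n (T1 T2 T3 : finType) (F : T1 -> T2 -> T3) (G : T3 -> A)
   (G1 : T1 -> A) (G2 : T2 -> A) (w1 : {ffun 'I_n -> T1}) (w2 : {ffun 'I_n -> T2}) :
  (forall a b, G (F a b) = G1 a - G2 b) ->
  mapv G (map2v F w1 w2) = mapv G1 w1 - mapv G2 w2.
Proof. by move=> e; apply/ffunP => i; rewrite !ffunE e. Qed.

Lemma mapv_map2vBr n (T1 T2 T3 : finType) (F : T1 -> T2 -> T3) (G : T3 -> A)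
   (G1 : T1 -> A) (G2 : T2 -> A) (w1 : {ffun 'I_n -> T1}) (w2 : {ffun 'I_n -> T2}) :
  (forall a b, G (F a b) = G2 b - G1 a) ->
  mapv G (map2v F w1 w2) = mapv G2 w2 - mapv G1 w1.
Proof. by move=> e; apply/ffunP => i; rewrite !ffunE e. Qed.

(* Doubling over the letter [c] of the arms [(c, w1)] and [(c, w2)] gives the arm [(x w1, w2)].
   The visible part of the trivial arm at [w] depends on [z w] only, so that [arm_chain] can
   connect trivial arms along [z]. *)
Lemma arm_walk (j : nat) :
  exists (V : finType) (phi : forall n, St n -> {ffun 'I_n -> V} -> {ffun 'I_n -> A})
    (v0 : Z -> V) (D' : X * T * V * A -> Prop),
  [/\ adm val D' (arm_event phi),
      forall w, D w -> D' (x w, w, v0 (z w), 0),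
      forall w1 w2, D w1 -> D w2 -> y w1 = y w2 -> exists v a, D' (x w1, w2, v, a) &
      forall w b, D w -> reach (share D x y) j (x w) b -> exists v a, D' (b, w, v, a)].
Proof.
elim: j => [|j [V [phi [v0 [D' [D'adm Ddiag Dy Dreach]]]]]].
  (* Subtracting the winning equations of two samples with the same [y] cancels [g]; the [h] terms
     become the visible part. *)
  pose F c1 c2 := (x c1, c2, (z c1, z c2), t c1 - t c2).
  pose phi n (s : St n) (v : {ffun 'I_n -> Z * Z}) := h s (mapv snd v) - h s (mapv fst v).
  pose D' b := exists c1 c2, [/\ F c1 c2 = b, D c1, D c2 & y c1 = y c2].
  exists (Z * Z)%type, phi, (fun c => (c, c)), D'.
  have Dd w : D w -> D' (x w, w, (z w, z w), 0).
    by move=> Dw; exists w, w; split=> //; rewrite /F subrr.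
  split=> //.
  - apply: (adm_dbl val01 (u := y) (F := F) DQ) => // n s c1 c2 Q1 Q2 yc.
    split; first by rewrite (mapv_map2vr (G1 := id)) // mapv_id.
    rewrite (mapv_map2vl (G1 := x)) // (mapv_map2vr (G1 := x)) //.
    rewrite (mapv_map2vB (G1 := t) (G2 := t)) // /phi !mapv_comp.
    rewrite (mapv_map2vr (G1 := z)) // (mapv_map2vl (G1 := z)) //.
    by rewrite -(HQ Q1) -(HQ Q2) yc -cancel_middle.
  - by move=> w1 w2 D1 D2 y12; exists (z w1, z w2), (t w1 - t w2), w1, w2.
  - by move=> w b Dw <-; exists (z w, z w), 0; apply: Dd.
pose F (c1 c2 : X * T * V * A) := (x c1.1.1.2, c2.1.1.2, (c1.1.2, c2.1.2), c2.2 - c1.2).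
pose u (c : X * T * V * A) := c.1.1.1.
pose phi' n (s : St n) (v : {ffun 'I_n -> V * V}) := phi n s (mapv snd v) - phi n s (mapv fst v).
pose D'' b := exists c1 c2, [/\ F c1 c2 = b, D' c1, D' c2 & u c1 = u c2].
exists (V * V)%type, phi', (fun c => (v0 c, v0 c)), D''; split.
- apply: (adm_dbl val01 (u := u) (F := F) D'adm) => // n s c1 c2 [_ e1] [Q2 e2] uc.
  split; first by rewrite (mapv_map2vr (G1 := fun a => a.1.1.2)).
  rewrite (mapv_map2vl (G1 := fun a => x a.1.1.2)) // (mapv_map2vr (G1 := fun a => x a.1.1.2)) //.
  rewrite (mapv_map2vBr (G1 := snd) (G2 := snd)) // /phi' !mapv_comp.
  rewrite (mapv_map2vr (G1 := fun a => a.1.2)) // (mapv_map2vl (G1 := fun a => a.1.2)) //.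
  by rewrite addrACA -opprD -e2 -e1 uc opprB [RHS]addrC subrKA.
- move=> w Dw; exists (x w, w, v0 (z w), 0), (x w, w, v0 (z w), 0).
  by split; rewrite ?/F ?subrr //; apply: Ddiag.
- move=> w1 w2 D1 D2 y12; have [v [a h1]] := Dy _ _ D2 D1 (esym y12).
  exists (v, v0 (z w2)), (0 - a), (x w2, w1, v, a), (x w2, w2, v0 (z w2), 0).
  by split=> //; apply: Ddiag.
move=> w b Dw /= [c rc [w1 [w2 [D1 D2 x1 x2 y12]]]].
have [v [a h1]] := Dreach _ _ Dw rc; have [v' [a' h2]] := Dy _ _ D1 D2 y12.
exists (v', v), (a - a'), (x w1, w2, v', a'), (c, w, v, a); split=> //.
by rewrite /F /= x2.
Qed.

(* Two arms with the same visible part: the letters of the second one become visible. *)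
Definition arm_square (V : finType) (D1 : X * T * V * A -> Prop) (b : X * T * (X * X) * A) : Prop :=
  exists x1 w1 a1 x2 w2 a2 v,
    [/\ b = (x1, w1, (x2, x w2), a1 - a2), D1 (x1, w1, v, a1) & D1 (x2, w2, v, a2)].

Lemma adm_arm_square (V : finType) phi (D1 : X * T * V * A -> Prop) :
  adm val D1 (arm_event phi) -> adm val (arm_square D1) (arm_event diff_fun).
Proof.
move=> D1adm.
pose F (c1 c2 : X * T * V * A) := (c1.1.1.1, c1.1.1.2, (c2.1.1.1, x c2.1.1.2), c1.2 - c2.2).
pose u (c : X * T * V * A) := c.1.2.
apply: (adm_dbl val01 (u := u) (F := F) D1adm) => [b|n s c1 c2 [Q1 e1] [_ e2] uc].
  move=> [x1 [w1 [a1 [x2 [w2 [a2 [v [-> h1 h2]]]]]]]].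
  by exists (x1, w1, v, a1), (x2, w2, v, a2).
split; first by rewrite (mapv_map2vl (G1 := fun a => a.1.1.2)).
rewrite /diff_fun !mapv_comp.
rewrite (mapv_map2vl (G1 := fun a => a.1.1.1)) // (mapv_map2vl (G1 := fun a => x a.1.1.2)) //.
rewrite (mapv_map2vr (G1 := fun a => a.1.1.1)) // (mapv_map2vr (G1 := fun a => x a.1.1.2)) //.
rewrite (mapv_map2vB (G1 := snd) (G2 := snd)) // e1 e2 -[mapv _ c1]/(mapv u c1) uc.
by rewrite -addrA [X in _ = _ + X]addrC subrK.
Qed.

(* Repeated squaring connects all the trivial arms to a common visible part. *)
Lemma arm_chain (J K : nat) :
  (forall a b, reach (share D x y) J a b) ->
  exists D' : X * T * (X * X) * A -> Prop,
  [/\ adm val D' (arm_event diff_fun),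
      forall w b, D w -> D' (b, w, (b, x w), 0),
      forall w1 w2, D w1 -> D w2 -> z w1 = z w2 -> D' (x w1, w1, (x w2, x w2), 0) &
      forall w b, D w -> reach (share D x z) K (x w) b -> D' (x w, w, (b, b), 0)].
Proof.
move=> yconn.
elim: K => [|K [D' [D'adm Did Dz Dreach]]].
  have [V [phi [v0 [D1 [D1adm Ddiag _ Dfull]]]]] := arm_walk J.
  have Did w b : D w -> arm_square D1 (b, w, (b, x w), 0).
    move=> Dw; have [v [a h1]] := Dfull w b Dw (yconn _ _).
    by exists b, w, a, b, w, a, v; split; rewrite ?subrr.
  exists (arm_square D1); split; [exact: adm_arm_square D1adm|exact: Did| |].
    move=> w1 w2 D1w D2w z12.
    exists (x w1), w1, 0, (x w2), w2, 0, (v0 (z w1)); split; rewrite ?subrr //; first exact: Ddiag.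
    by rewrite z12; apply: Ddiag.
  by move=> w b Dw /= <-; apply: Did.
exists (arm_square D'); split; [exact: adm_arm_square D'adm| | |].
- move=> w b Dw; exists b, w, 0, b, w, 0, (b, x w).
  by split; rewrite ?subrr //; apply: Did.
- move=> w1 w2 D1 D2 z12.
  exists (x w1), w1, 0, (x w2), w2, 0, (x w2, x w2).
  by split; rewrite ?subrr //; [apply: Dz|apply: Did].
move=> w b Dw /= [c rc [w1 [w2 [D1 D2 x1 x2 z12]]]].
(* The trivial arms at [w] and at [w2] share the visible part [(c, c)]; squaring replaces it by
   [(b, b)], the letters of the second arm. *)
exists (x w), w, 0, b, w2, 0, (c, c); split; first by rewrite x2 subrr.
  exact: Dreach.
by rewrite -x1 -x2; apply: Dz.
Qed.

(** The second property puts all trivial arms over one visible part, as needed for the common [u0]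
    of a gadget; the first attaches arbitrary letters to a base sample. *)
Lemma arm (J K : nat) (x0 : X) :
  (forall a b, reach (share D x y) J a b) -> (forall a b, reach (share D x z) K a b) ->
  exists D' : X * T * (X * X) * A -> Prop,
  [/\ adm val D' (arm_event diff_fun),
      forall w b, D w -> D' (b, w, (b, x w), 0) &
      forall w, D w -> D' (x w, w, (x0, x0), 0)].
Proof.
move=> yconn zconn; have [D' [D'adm Did _ Dreach]] := arm_chain K yconn.
by exists D'; split=> // w Dw; apply: Dreach.
Qed.

End Arm.

(** * Gadgets and their blow-up *)

Lemma reach_mono (X : Type) (r r' : X -> X -> Prop) j a b :
  (forall a b, r a b -> r' a b) -> reach r j a b -> reach r' j a b.
Proof.
move=> rr; elim: j b => //= j IH b [c rc cb].
by exists c; [exact: IH|exact: rr].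
Qed.

Lemma add_three_diffs (V : zmodType) (f g h f' g' h' p q r a b c : V) :
  f - f' = p + a -> g - g' = q + b -> h - h' = r + c ->
  f + g + h = p + q + r + (f' + g' + h' + a + b + c).
Proof.
move=> e1 e2 e3; rewrite -(subrK f' f) -(subrK g' g) -(subrK h' h) e1 e2 e3 !addrA.
by rewrite [LHS](ACl (1*4*7*3*6*9*2*5*8)%AC).
Qed.

Section Gadget.
Variables (R : realType) (St : nat -> Type) (val : forall n, St n -> R).
Hypothesis val01 : forall n (s : St n), 0 <= val s <= 1.
Variables (A : finZmodType) (X Y Z : finType).
Variables (f : forall n, St n -> {ffun 'I_n -> X} -> {ffun 'I_n -> A}).
Variables (g : forall n, St n -> {ffun 'I_n -> Y} -> {ffun 'I_n -> A}).
Variables (h : forall n, St n -> {ffun 'I_n -> Z} -> {ffun 'I_n -> A}).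
Variables (t : X * Y * Z -> A) (D : X * Y * Z -> Prop).

Let px (s : X * Y * Z) := s.1.1.
Let py (s : X * Y * Z) := s.1.2.
Let pz (s : X * Y * Z) := s.2.

Definition win n (s : St n) (w : {ffun 'I_n -> X * Y * Z}) : Prop :=
  f s (mapv px w) + g s (mapv py w) + h s (mapv pz w) = mapv t w.

Hypothesis Dwin : adm val D win.
Variable J : nat.
Hypothesis xy_conn : forall a b, reach (share D px py) J a b.
Hypothesis xz_conn : forall a b, reach (share D px pz) J a b.
Hypothesis yx_conn : forall a b, reach (share D py px) J a b.
Hypothesis yz_conn : forall a b, reach (share D py pz) J a b.
Hypothesis zx_conn : forall a b, reach (share D pz px) J a b.
Hypothesis zy_conn : forall a b, reach (share D pz py) J a b.
Variable s0 : X * Y * Z.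
Hypothesis Ds0 : D s0.

Definition gadget_event (U : finType)
    (phi : forall n, St n -> {ffun 'I_n -> U} -> {ffun 'I_n -> A})
    n (s : St n) (w : {ffun 'I_n -> X * (Y * Z) * (U * A)}) : Prop :=
  f s (mapv (fun c => c.1.1) w) + g s (mapv (fun c => c.1.2.1) w) +
  h s (mapv (fun c => c.1.2.2) w) =
  phi n s (mapv (fun c => c.2.1) w) + mapv (fun c => c.2.2) w.

Lemma reach_share_lift (V V' T1 T2 : Type) (v1 : T1 -> V) (v2 : T2 -> V) (v1' : T1 -> V')
    (v2' : T2 -> V') (D1 : T1 -> Prop) (D2 : T2 -> Prop) (e : T1 -> T2) j a b :
  (forall w, D1 w -> [/\ D2 (e w), v2 (e w) = v1 w & v2' (e w) = v1' w]) ->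
  reach (share D1 v1 v1') j a b -> reach (share D2 v2 v2') j a b.
Proof.
move=> he; apply: reach_mono => a' b' [w1 [w2 [D1w D2w <- <- eqv]]].
have [D1e e1 e1'] := he _ D1w; have [D2e e2 e2'] := he _ D2w.
by exists (e w1), (e w2); split; rewrite ?e1' ?e2'.
Qed.

(** Three arms are attached in turn, for [x], [y] and [z], each taking the previous construction as
    its base. Their equations add up with the winning equation of the innermost sample. *)
Lemma gadget_exists :
  exists (U : finType) (phi : forall n, St n -> {ffun 'I_n -> U} -> {ffun 'I_n -> A})
    (u0 : U) (D' : X * (Y * Z) * (U * A) -> Prop),
  [/\ adm val D' (gadget_event phi),
      forall x y z, exists u a, D' (x, (y, z), (u, a)) &
      forall s, D s -> D' (px s, (py s, pz s), (u0, t s))].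
Proof.
have winx n (s : St n) w : win s w ->
  f s (mapv px w) + g s (mapv py w) + h s (mapv pz w) = mapv t w by [].
have [D1 [D1adm D1id D1diag]] :=
  arm val01 Dwin winx (px s0) xy_conn xz_conn.
pose T1 := (X * (X * Y * Z) * (X * X) * A)%type; pose b1 (c : T1) := c.1.1.2.
have win1 n (s : St n) w : arm_event f px win (diff_fun f) s w ->
    g s (mapv (py \o b1) w) + f s (mapv (px \o b1) w) + h s (mapv (pz \o b1) w) =
    mapv (t \o b1) w.
  by move=> [e _]; rewrite (addrC (g _ _)); move: e; rewrite /win !mapv_comp.
(* Trivial arms embed [D] into the new base without changing letters, so connectivity carries
   over. *)
pose l1 (w : X * Y * Z) : T1 := (px w, w, (px s0, px s0), 0).
have [D2 [D2adm D2id D2diag]] : exists D' : Y * T1 * (Y * Y) * A -> Prop,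
  [/\ adm val D' (arm_event g (py \o b1) (arm_event f px win (diff_fun f)) (diff_fun g)),
      forall w b, D1 w -> D' (b, w, (b, py (b1 w)), 0) &
      forall w, D1 w -> D' (py (b1 w), w, (py s0, py s0), 0)].
  apply: (arm (x := py \o b1) (y := px \o b1) (z := pz \o b1) val01 D1adm win1 (py s0)
    (J := J) (K := J)) => a b.
    by apply: (reach_share_lift (e := l1)) (yx_conn a b) => w Dw; split=> //; apply: D1diag.
  by apply: (reach_share_lift (e := l1)) (yz_conn a b) => w Dw; split=> //; apply: D1diag.
pose T2 := (Y * T1 * (Y * Y) * A)%type; pose b2 (c : T2) := c.1.1.2.
set Q2 := arm_event _ _ _ _ in D2adm.
have win2 n (s : St n) w : Q2 n s w ->
    h s (mapv (pz \o b1 \o b2) w) + f s (mapv (px \o b1 \o b2) w) +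
      g s (mapv (py \o b1 \o b2) w) = mapv (t \o b1 \o b2) w.
  by move=> [[e _] _]; rewrite -addrA addrC; move: e; rewrite /win !mapv_comp.
pose l2 (w : X * Y * Z) : T2 := (py w, l1 w, (py s0, py s0), 0).
have [D3 [D3adm D3id D3diag]] : exists D' : Z * T2 * (Z * Z) * A -> Prop,
  [/\ adm val D' (arm_event h (pz \o b1 \o b2) Q2 (diff_fun h)),
      forall w b, D2 w -> D' (b, w, (b, pz (b1 (b2 w))), 0) &
      forall w, D2 w -> D' (pz (b1 (b2 w)), w, (pz s0, pz s0), 0)].
  apply: (arm (x := pz \o b1 \o b2) (y := px \o b1 \o b2) (z := py \o b1 \o b2) val01 D2adm win2
    (pz s0) (J := J) (K := J)) => a b.
    apply: (reach_share_lift (e := l2)) (zx_conn a b) => w Dw; split=> //.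
    exact/(D2diag (l1 w))/D1diag.
  apply: (reach_share_lift (e := l2)) (zy_conn a b) => w Dw; split=> //.
  exact/(D2diag (l1 w))/D1diag.
pose U := (X * X * (Y * Y) * (Z * Z))%type.
pose F (c : Z * T2 * (Z * Z) * A) : X * (Y * Z) * (U * A) :=
  let c2 := c.1.1.2 in let c1 := c2.1.1.2 in let s := c1.1.1.2 in
  (c1.1.1.1, (c2.1.1.1, c.1.1.1), ((c1.1.2, c2.1.2, c.1.2), t s + c1.2 + c2.2 + c.2)).
pose phi n (s : St n) (v : {ffun 'I_n -> U}) : {ffun 'I_n -> A} :=
  diff_fun f s (mapv (fun u => u.1.1) v) + diff_fun g s (mapv (fun u => u.1.2) v) +
  diff_fun h s (mapv (fun u => u.2) v).
exists U, phi, ((px s0, px s0), (py s0, py s0), (pz s0, pz s0)).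
exists (fun b => exists2 c, F c = b & D3 c); split.
- apply: (adm_map val01 (F := F) D3adm) => // n s c [[[Q0 e1] e2] e3].
  move: Q0 e1 e2 e3; rewrite /win /gadget_event /phi /diff_fun !mapv_comp => Q0 e1 e2 e3.
  have -> : mapv ((fun b => b.2.2) \o F) c =
     mapv (t \o b1 \o b2 \o (fun c => c.1.1.2)) c + mapv (fun c => c.1.1.2.1.1.2.2) c +
     mapv (fun c => c.1.1.2.2) c + mapv (fun c => c.2) c.
    by apply/ffunP => i; rewrite !ffunE.
  rewrite -[mapv (t \o _ \o _ \o _) c]Q0.
  exact: add_three_diffs e1 e2 e3.
- move=> x y z.
  (* All three letters are attached to the single base sample [s0]. *)
  pose c1 : T1 := (x, s0, (x, px s0), 0); pose c2 : T2 := (y, c1, (y, py s0), 0).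
  have D1c : D1 c1 by exact: D1id.
  have D2c : D2 c2 by exact: (D2id c1).
  by eexists _, _, (z, c2, (z, pz s0), 0); [reflexivity|exact: (D3id c2)].
- move=> s Ds; exists (pz s, l2 s, (pz s0, pz s0), 0).
    by rewrite /F /= !addr0.
  exact/(D3diag (l2 s))/(D2diag (l1 s))/D1diag.
Qed.

(** * Blow-up over all letters and the defect modulo [d] *)

Variables (lam : X * Y * Z -> int) (d : int).
Variables (vx : X -> int) (vy : Y -> int) (vz : Z -> int).
Hypothesis lamD : forall s, lam s != 0 -> D s.
Hypothesis lamx : forall a, \sum_(s | px s == a) lam s = d * vx a.
Hypothesis lamy : forall a, \sum_(s | py s == a) lam s = d * vy a.
Hypothesis lamz : forall a, \sum_(s | pz s == a) lam s = d * vz a.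
Hypothesis lamt : forall b, \sum_s t s *~ lam s != b *~ d.

Lemma blowup_exists :
  exists (U : finType) (phi : forall n, St n -> {ffun 'I_n -> U} -> {ffun 'I_n -> A})
    (u0 : U) (D' : X * (Y * Z) * (U * A) -> Prop),
  let B := ({ffun Z -> Z} * ({ffun X -> X} * {ffun Y -> Y}) *
            {ffun Z -> {ffun Y -> {ffun X -> U * A}}})%type in
  [/\ adm val
        (fun b : B => forall x y z, D' (b.1.2.1 x, (b.1.2.2 y, b.1.1 z), b.2 z y x))
        (fun n s w => forall x y z, gadget_event phi s
           (mapv (fun b : B => (b.1.2.1 x, (b.1.2.2 y, b.1.1 z), b.2 z y x)) w)),
      forall x y z, exists u a, D' (x, (y, z), (u, a)) &
      forall s, D s -> D' (px s, (py s, pz s), (u0, t s))].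
Proof.
have [U [phi [u0 [D1 [D1adm D1full D1diag]]]]] := gadget_exists.
exists U, phi, u0, D1; split=> //.
have X0 : (0 < #|X|)%N by apply/card_gt0P; exists (px s0).
have Y0 : (0 < #|Y|)%N by apply/card_gt0P; exists (py s0).
have Z0 : (0 < #|Z|)%N by apply/card_gt0P; exists (pz s0).
have B1 := adm_blowup val01 X0 D1adm.
(* The components are permuted so that the next type of letter, here [Y], takes the resampled
   position. *)
pose F1 (c : {ffun X -> X} * (Y * Z) * {ffun X -> U * A}) :=
  (c.1.2.1, (c.1.1, c.1.2.2), c.2).
have B1' : adm val
    (fun b : Y * ({ffun X -> X} * Z) * {ffun X -> U * A} =>
       forall x, D1 (b.1.2.1 x, (b.1.1, b.1.2.2), b.2 x))
    (fun n s w => forall x, gadget_event phi s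
       (mapv (fun b : Y * ({ffun X -> X} * Z) * {ffun X -> U * A} =>
                (b.1.2.1 x, (b.1.1, b.1.2.2), b.2 x)) w)).
  apply: (adm_map val01 (F := F1) B1) => [[[y [xs z]] v] /= Db|n s c Qc x].
    by exists (xs, (y, z), v).
  have := Qc x; rewrite mapv_comp; congr gadget_event.
  by apply/ffunP => i; rewrite !ffunE; case: (c i) => [[? []]].
have B2 := adm_blowup val01 Y0 B1'.
pose F2 (c : {ffun Y -> Y} * ({ffun X -> X} * Z) * {ffun Y -> {ffun X -> U * A}}) :=
  (c.1.2.2, (c.1.2.1, c.1.1), c.2).
have B2' : adm val
    (fun b : Z * ({ffun X -> X} * {ffun Y -> Y}) * {ffun Y -> {ffun X -> U * A}} =>
       forall y x, D1 (b.1.2.1 x, (b.1.2.2 y, b.1.1), b.2 y x))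
    (fun n s w => forall y x, gadget_event phi s
       (mapv (fun b : Z * ({ffun X -> X} * {ffun Y -> Y}) * {ffun Y -> {ffun X -> U * A}} =>
                (b.1.2.1 x, (b.1.2.2 y, b.1.1), b.2 y x)) w)).
  apply: (adm_map val01 (F := F2) B2) => [[[z [xs ys]] v] /= Db|n s c Qc y x].
    by exists (ys, (xs, z), v).
  by have := Qc y x; rewrite !mapv_comp.
have B3 := adm_blowup val01 Z0 B2'.
apply: (adm_map val01 (F := id) B3) => [b Db|n s c Qc x y z].
  by exists b => // z y x; apply: Db.
by have := Qc z y x; rewrite !mapv_comp.
Qed.

(** Grouping the triples by their letter turns the weights into letter masses, all divisible by
    [d]. *)
Lemma sum_letter (L : finType) (p : X * Y * Z -> L) (v : L -> int) (F : L -> A) :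
  (forall a, \sum_(s | p s == a) lam s = d * v a) ->
  \sum_s F (p s) *~ lam s = (\sum_a F a *~ v a) *~ d.
Proof.
move=> lamp; rewrite (partition_big p predT) //= mulrz_suml; apply: eq_bigr => a _.
rewrite -mulrzA [v a * d]mulrC -lamp mulrz_sumr.
by apply: eq_bigr => s /eqP->.
Qed.

(* The Boolean records whether the lam-weighted sums of two samples agree modulo [d]. *)
Lemma defect : adm val (fun b : bool => b = false) (fun n s w => forall i, w i = true).
Proof.
have [U [phi [u0 [D1 [Badm D1full D1diag]]]]] := blowup_exists.
set B := (_ * _ * _)%type in Badm.
pose a_ (b : B) s := (b.2 (pz s) (py s) (px s)).2.
(* Only triples of nonzero weight need equal visible parts; the others are masked by [u0]. *)
pose u (b : B) : {ffun X * Y * Z -> U} :=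
  [ffun s => if lam s == 0 then u0 else (b.2 (pz s) (py s) (px s)).1].
pose F (b1 b2 : B) : bool :=
  `[< exists c, \sum_s (a_ b1 s - a_ b2 s) *~ lam s = c *~ d >].
apply: (adm_dbl val01 (u := u) (F := F) Badm) => [b ->|n s b1 b2 Q1 Q2 ub i].
  (* Outside [D] any gadget on the triple serves as a filler, since [lam] vanishes there. *)
  have /choice[ua uaP] (s : X * Y * Z) : exists c : U * A,
      D1 (px s, (py s, pz s), c) /\ (D s -> c = (u0, t s)).
    have [Ds|nDs] := EM (D s); first by exists (u0, t s); split=> //; apply: D1diag.
    by have [v [a Dva]] := D1full (px s) (py s) (pz s); exists (v, a).
  pose b1 : B := ([ffun z => z], ([ffun x => x], [ffun y => y]),
    [ffun z => [ffun y => [ffun x => ua (x, y, z)]]]).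
  pose b2 : B := ([ffun=> pz s0], ([ffun=> px s0], [ffun=> py s0]),
    [ffun=> [ffun=> [ffun=> (u0, t s0)]]]).
  have usE s : (px s, py s, pz s) = s by case: s => [[]].
  exists b1, b2; split.
  (* The sum for [b1] is that of [lam] times [t]; for [b2] it is [t s0] times the total mass of
     [lam], a multiple of [d]. Agreement would contradict [lamt]. *)
  - apply/asboolPn => -[c]; under eq_bigr do rewrite mulrzBl.
    rewrite sumrB; have -> : \sum_s a_ b1 s *~ lam s = \sum_s t s *~ lam s.
      apply: eq_bigr => s _; have [->|/lamD Ds] := eqVneq (lam s) 0; first by rewrite !mulr0z.
      by rewrite /a_ !ffunE usE (uaP s).2.
    have -> : \sum_s a_ b2 s *~ lam s = \sum_s t s0 *~ lam s.
      by apply: eq_bigr => s _; rewrite /a_ !ffunE.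
    rewrite (sum_letter (fun _ => t s0) lamx) => /(canRL (subrK _)).
    by rewrite -mulrzDl => /eqP; apply/negP.
  - by move=> x y z; rewrite !ffunE; have [] := uaP (x, y, z).
  - by move=> x y z; rewrite !ffunE; apply: D1diag.
  - apply/ffunP => s; rewrite !ffunE; have [//|/lamD Ds] := eqVneq (lam s) 0.
    by rewrite usE (uaP s).2.
rewrite ffunE; apply/asboolP.
pose f_ (b : {ffun 'I_n -> B}) x := f s (mapv (fun c : B => c.1.2.1 x) b) i.
pose g_ (b : {ffun 'I_n -> B}) y := g s (mapv (fun c : B => c.1.2.2 y) b) i.
pose h_ (b : {ffun 'I_n -> B}) z := h s (mapv (fun c : B => c.1.1 z) b) i.
pose p_ (b : {ffun 'I_n -> B}) r :=
  phi n s (mapv (fun c : B => (c.2 (pz r) (py r) (px r)).1) b) i.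
have rel (b : {ffun 'I_n -> B}) r :
    (forall x y z, gadget_event phi s
      (mapv (fun b : B => (b.1.2.1 x, (b.1.2.2 y, b.1.1 z), b.2 z y x)) b)) ->
    f_ b (px r) + g_ b (py r) + h_ b (pz r) = p_ b r + a_ (b i) r.
  move=> /(_ (px r) (py r) (pz r)); rewrite /gadget_event !mapv_comp.
  move=> /(congr1 (fun w : {ffun 'I_n -> A} => w i)).
  by rewrite !ffunE.
have pE r : lam r != 0 -> p_ b1 r = p_ b2 r.
  move=> /negbTE lr; congr (phi n s _ i); apply/ffunP => j; rewrite !ffunE.
  have := congr1 (fun w : {ffun 'I_n -> {ffun X * Y * Z -> U}} => w j r) ub.
  by rewrite !ffunE lr.
(* Equal visible parts make the [phi] terms cancel, so the difference consists of letter
   contributions, to which [sum_letter] applies. *)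
exists (\sum_x (f_ b1 x - f_ b2 x) *~ vx x + \sum_y (g_ b1 y - g_ b2 y) *~ vy y +
   \sum_z (h_ b1 z - h_ b2 z) *~ vz z).
rewrite !mulrzDl -(sum_letter _ lamx) -(sum_letter _ lamy) -(sum_letter _ lamz) -!big_split /=.
apply: eq_bigr => r _; have [->|lr] := eqVneq (lam r) 0; first by rewrite !mulr0z !addr0.
rewrite -!mulrzDl; congr (_ *~ _).
have e1 := rel _ r Q1; have e2 := rel _ r Q2.
rewrite (addrACA (f_ b1 _)) -opprD addrACA -opprD e1 e2 pE //.
by rewrite (addrC (p_ b2 r)) addrKA.
Qed.

End Gadget.

(** * Linear systems over the integers *)

Section IntegerSystem.
Variable A : zmodType.

Definition zact m n (B : 'M[int]_(m, n)) (v : 'I_n -> A) (i : 'I_m) : A :=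
  \sum_j v j *~ B i j.

Lemma zact_mul m n p (B : 'M[int]_(m, n)) (C : 'M[int]_(n, p)) v i :
  zact (B *m C) v i = zact B (zact C v) i.
Proof.
rewrite /zact; under [RHS]eq_bigr do rewrite mulrz_suml.
rewrite exchange_big /=; apply: eq_bigr => k _; rewrite mxE mulrz_sumr.
by apply: eq_bigr => j _; rewrite -mulrzA mulrC.
Qed.

Lemma zact1 n v (i : 'I_n) : zact 1%:M v i = v i.
Proof.
rewrite /zact (bigD1 i) //= mxE eqxx mulr1z big1 ?addr0 // => j ji.
by rewrite mxE eq_sym (negbTE ji) mulr0z.
Qed.

Lemma eq_zact m n (B : 'M[int]_(m, n)) v w i : v =1 w -> zact B v i = zact B w i.
Proof. by move=> vw; apply: eq_bigr => j _; rewrite vw. Qed.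

(** With the Smith form [M = L D G], solvability means that each entry of [L^-1 t] is divisible by
    the matching diagonal entry. The hypothesis for row [i] of [L^-1] and [d = e i] says just
    this. *)
Lemma mx_system_solvable m n (M : 'M[int]_(m, n)) (t : 'I_m -> A) :
  (forall (d : int) (lam : 'rV_m), (forall j, exists v, (lam *m M) 0 j = d * v) ->
     exists b, zact lam t 0 = b *~ d) ->
  exists u, forall i, zact M u i = t i.
Proof.
have [L uL [G uG [d _ ->]]] := int_Smith_normal_form M => H.
set D := \matrix_(_, _) _ in H *.
(* Rows below the diagonal block are zero; there [e i = 0] forces the entry to vanish. *)
pose e (i : 'I_m) := if (i < n)%N then d`_i else 0.
have /choice[a aP] (i : 'I_m) : exists b, zact (invmx L) t i = b *~ e i.
  have := H (e i) (row i (invmx L)); rewrite !mulmxA -row_mul mulVmx // row1.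
  have -> : zact (row i (invmx L)) t 0 = zact (invmx L) t i.
    by apply: eq_bigr => k _; rewrite mxE.
  apply=> j; exists (\sum_(k < n) ((i : nat) == k)%:R * G k j).
  rewrite -rowE !mxE mulr_sumr; apply: eq_bigr => k _; rewrite !mxE /e.
  case: ltnP => [_|ni].
    by case: eqP => _; rewrite ?mulr1n ?mulr0n ?mul1r ?mul0r ?mulr0 ?mulr1.
  by rewrite (gtn_eqF (leq_trans (ltn_ord k) ni)) mulr0n !mul0r.
(* Unknowns beyond the number of equations are free and set to 0. *)
pose w (k : 'I_n) := if insub (k : nat) is Some i then a i else 0.
exists (zact (invmx G) w) => i.
transitivity (zact L (zact (invmx L) t) i); last by rewrite -zact_mul mulmxV // zact1.
rewrite -zact_mul -!mulmxA mulmxV // mulmx1 zact_mul.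
apply: eq_zact => {}i; rewrite aP /zact /e.
case: ltnP => [ni|ni].
  rewrite (bigD1 (Ordinal ni)) //= big1 => [|k ki].
    by rewrite !mxE eqxx mulr1n addr0 /w /= valK.
  by rewrite !mxE -val_eqE eq_sym in ki *; rewrite (negbTE ki) mulr0n mulr0z.
rewrite mulr0z big1 // => k _.
by rewrite !mxE (gtn_eqF (leq_trans (ltn_ord k) ni)) mulr0n mulr0z.
Qed.

Lemma system_solvable (I J : finType) (M : I -> J -> int) (t : I -> A) :
  (forall (d : int) (lam : I -> int),
     (forall j, exists v, \sum_i lam i * M i j = d * v) ->
     exists b, \sum_i t i *~ lam i = b *~ d) ->
  exists u : J -> A, forall i, \sum_j u j *~ M i j = t i.
Proof.
move=> H.
have [|u uP] := @mx_system_solvable #|I| #|J| (\matrix_(i, j) M (enum_val i) (enum_val j))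
    (fun i => t (enum_val i)).
  move=> d lam lamM; have [j|b bP] := H d (fun i => lam 0 (enum_rank i)).
    have [v vP] := lamM (enum_rank j); exists v; rewrite -vP mxE.
    rewrite (reindex enum_rank) /=; last exact/onW_bij/enum_rank_bij.
    by apply: eq_bigr => i _; rewrite !mxE !enum_rankK.
  exists b; rewrite -bP /zact (reindex enum_rank) /=; last exact/onW_bij/enum_rank_bij.
  by apply: eq_bigr => i _; rewrite enum_rankK.
exists (fun j => u (enum_rank j)) => i.
rewrite -[t i](congr1 t (enum_rankK i)) -uP /zact.
rewrite [RHS](reindex enum_rank) /=; last exact/onW_bij/enum_rank_bij.
by apply: eq_bigr => j _; rewrite mxE !enum_rankK.
Qed.

End IntegerSystem.

(** * Repeated XOR games *)

Section Connectivity.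
Variables (T X V : finType) (D : T -> Prop) (x : T -> X) (v : T -> V).
Hypothesis rigid : forall (F : X -> int) (G : V -> int),
  (forall s, D s -> F (x s) + G (v s) = 0) -> forall a b, F a = F b.
Variable s0 : T.
Hypothesis Ds0 : D s0.

Lemma share_refl a : share D x v a a.
Proof.
suff [w [Dw xw]] : exists w, D w /\ x w = a by exists w, w.
apply: contrapT => nsupp.
(* If [a] did not occur in [D], its indicator paired with 0 would satisfy the equations without
   being constant. *)
have := @rigid (fun b => (b == a)%:R) (fun=> 0) _ a (x s0).
rewrite eqxx; case: eqP => [xs0 _|_ h]; first by apply: nsupp; exists s0.
by have := h _; apply/not_implyP; split=> [w Dw|//]; case: eqP => // xw; case: nsupp; exists w.
Qed.

Lemma reach_le j k a b : (j <= k)%N -> reach (share D x v) j a b -> reach (share D x v) k a b.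
Proof.
move=> /subnK <-; elim: (k - j)%N => // m IH /IH h.
by rewrite addSn /=; exists b => //; apply: share_refl.
Qed.

(** The indicator of the component of [a], with minus the indicator of the [v]-values met by it,
    satisfies the equations of [rigid], so the component is everything. A simple path has fewer than
    [#|X|] steps, and loops pad it. *)
Lemma reach_card a b : reach (share D x v) #|X| a b.
Proof.
pose r : rel X := fun a b => `[< share D x v a b >].
have rab : connect r a b.
  pose F c : int := (connect r a c)%:R.
  pose G c : int := - (`[< exists s, [/\ D s, v s = c & connect r a (x s)] >])%:R.
  suff FG s : D s -> F (x s) + G (v s) = 0.
    have := rigid FG a b; rewrite /F connect0.
    by case: (connect r a b).
  move=> Ds; rewrite /F /G; apply/eqP; rewrite subr_eq0; apply/eqP.
  congr (_%:R); congr (nat_of_bool _); apply/idP/asboolP => [h|[s' [Ds' vs' h]]]; first by exists s.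
  by apply: connect_trans h (connect1 _); apply/asboolP; exists s', s.
have /connectP[p0 p0path ->] := rab; have [p ppath puniq _] := shortenP p0path.
apply: (@reach_le (size p)).
  by apply: ltnW; rewrite -[(size p).+1]/(size (a :: p)) -(card_uniqP puniq) max_card.
elim/last_ind: p ppath {puniq} => //= p c IH; rewrite rcons_path last_rcons size_rcons.
by move=> /andP[/IH h /asboolP pc]; exists (last a p).
Qed.

End Connectivity.

(** * Obstruction to perfect strategies and decay of the value *)

Section Game.
Variables (R : realType) (Sigma Gamma Phi : finType) (A : finZmodType).
Variables (mu : Sigma -> Gamma -> Phi -> R) (t : Sigma -> Gamma -> Phi -> A).

Let T := (Sigma * Gamma * Phi)%type.
Let muT (s : T) := mu s.1.1 s.1.2 s.2.
Let tT (s : T) := t s.1.1 s.1.2 s.2.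

Hypothesis mu_distr : is_distr mu.
Hypothesis val_lt1 : game_val mu t < 1.
Hypothesis noZ : no_Z_embeddings mu.

Lemma sum_muT : \sum_s muT s = 1.
Proof. by have [_ <-] := mu_distr; rewrite !pair_bigA. Qed.

Lemma muT_ge0 s : 0 <= muT s. Proof. by have [h _] := mu_distr; apply: h. Qed.

Lemma game_unsolvable (f : Sigma -> A) (g : Gamma -> A) (h : Phi -> A) :
  ~ (forall s, muT s != 0 -> f s.1.1 + g s.1.2 + h s.2 = tT s).
Proof.
move=> sol; move: val_lt1; apply/negP; rewrite -leNgt.
apply: le_trans (le_bigmax _ _ [ffun x => f x]).
apply: le_trans (le_bigmax _ _ [ffun x => g x]).
apply: le_trans (le_bigmax _ _ [ffun x => h x]).
apply: (@le_trans _ _ (\sum_x \sum_y \sum_z mu x y z)); first by have [_ ->] := mu_distr.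
apply: ler_sum => x _; apply: ler_sum => y _; apply: ler_sum => z _.
rewrite !ffunE; have [->|m0] := eqVneq (mu x y z) 0; first by rewrite mul0r.
by have := sol (x, y, z) m0; rewrite /tT /= => ->; rewrite eqxx /= mulr1n mulr1.
Qed.

(** A solution of the linear system on the support would be a perfect strategy, so the divisibility
    criterion of [system_solvable] must fail for some [d] and [lam]. *)
Lemma obstruction : exists (lam : T -> int) (d : int) (vx : Sigma -> int)
    (vy : Gamma -> int) (vz : Phi -> int),
  [/\ forall s, lam s != 0 -> muT s != 0,
      forall a, \sum_(s | s.1.1 == a) lam s = d * vx a,
      forall a, \sum_(s | s.1.2 == a) lam s = d * vy a,
      forall a, \sum_(s | s.2 == a) lam s = d * vz a &
      forall b, \sum_s tT s *~ lam s != b *~ d].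
Proof.
apply: contrapT => nobs.
pose M (s : T) (l : Sigma + Gamma + Phi) : int :=
  if muT s == 0 then 0 else match l with
    | inl (inl a) => (s.1.1 == a)%:R
    | inl (inr a) => (s.1.2 == a)%:R
    | inr a => (s.2 == a)%:R end.
have [|u uP] := @system_solvable A T _ M (fun s => if muT s == 0 then 0 else tT s).
  move=> d lam /choice[v vP]; apply: contrapT => nb; apply: nobs.
  pose lam' s := if muT s == 0 then 0 else lam s.
  have lam'P l (c : pred T) : (forall s, muT s != 0 -> M s l = (c s)%:R) ->
      \sum_(s | c s) lam' s = d * v l.
    move=> cM; rewrite -vP big_mkcond; apply: eq_bigr => s _; rewrite /lam'.
    have [s0|s0] := eqVneq (muT s) 0; first by rewrite /M s0 eqxx mulr0 if_same.
    by rewrite cM //; case: (c s); rewrite ?mulr1 ?mulr0.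
  exists lam', d, (fun a => v (inl (inl a))), (fun a => v (inl (inr a))), (fun a => v (inr a)).
  split=> [s|a|a|a|b].
  - by rewrite /lam'; case: (muT s == 0).
  - by apply: lam'P => s /negbTE s0; rewrite /M s0.
  - by apply: lam'P => s /negbTE s0; rewrite /M s0.
  - by apply: lam'P => s /negbTE s0; rewrite /M s0.
  - apply/eqP => e; apply: nb; exists b; rewrite -e; apply: eq_bigr => s _.
    by rewrite /lam'; case: eqP; rewrite ?mulr0z ?mul0rz.
apply: (@game_unsolvable (fun a => u (inl (inl a))) (fun a => u (inl (inr a)))
  (fun a => u (inr a))) => s /negbTE s0.
have pick (L : finType) (w : L -> A) a : \sum_b w b *~ (a == b)%:R = w a.
  rewrite (bigD1 a) //= eqxx mulr1z big1 ?addr0 // => b ba.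
  by rewrite eq_sym (negbTE ba) mulr0z.
by have := uP s; rewrite s0 !big_sumType /= /M s0 !pick.
Qed.

Let St n := ({ffun {ffun 'I_n -> Sigma} -> {ffun 'I_n -> A}} *
  {ffun {ffun 'I_n -> Gamma} -> {ffun 'I_n -> A}} *
  {ffun {ffun 'I_n -> Phi} -> {ffun 'I_n -> A}})%type.
Let fS n (s : St n) : {ffun 'I_n -> Sigma} -> {ffun 'I_n -> A} := s.1.1.
Let gS n (s : St n) : {ffun 'I_n -> Gamma} -> {ffun 'I_n -> A} := s.1.2.
Let hS n (s : St n) : {ffun 'I_n -> Phi} -> {ffun 'I_n -> A} := s.2.
Let valS n (s : St n) : R := prob muT (win fS gS hS tT s).

Lemma valS_01 n (s : St n) : 0 <= valS s <= 1.
Proof.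
apply/andP; split.
  by apply: sumr_ge0 => w _; rewrite mulr_ge0 ?ler0n ?prodr_ge0 // => i _; apply: muT_ge0.
apply: (@le_trans _ _ (\sum_(w : {ffun 'I_n -> T}) \prod_i muT (w i))).
  apply: ler_sum => w _; rewrite ler_piMr ?lern1 ?leq_b1 //.
  by apply: prodr_ge0 => i _; apply: muT_ge0.
rewrite -(bigA_distr_bigA (fun (_ : 'I_n) a => muT a)) /=.
by rewrite big1 // => i _; apply: sum_muT.
Qed.

Lemma strategy_sum n (f : {ffun {ffun 'I_n -> Sigma} -> {ffun 'I_n -> A}})
    (g : {ffun {ffun 'I_n -> Gamma} -> {ffun 'I_n -> A}})
    (h : {ffun {ffun 'I_n -> Phi} -> {ffun 'I_n -> A}}) :
  \sum_(x : {ffun 'I_n -> Sigma}) \sum_(y : {ffun 'I_n -> Gamma})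
    \sum_(z : {ffun 'I_n -> Phi}) (\prod_(i < n) mu (x i) (y i) (z i)) *
      [forall i : 'I_n, f x i + g y i + h z i == t (x i) (y i) (z i)]%:R =
  valS ((f, g, h) : St n).
Proof.
rewrite !pair_bigA /=.
pose spl (w : {ffun 'I_n -> T}) :=
  (mapv (fun s : T => s.1.1) w, mapv (fun s : T => s.1.2) w, mapv (fun s : T => s.2) w).
pose mrg (c : {ffun 'I_n -> Sigma} * {ffun 'I_n -> Gamma} * {ffun 'I_n -> Phi}) :
    {ffun 'I_n -> T} := [ffun i => (c.1.1 i, c.1.2 i, c.2 i)].
rewrite (reindex spl) /=; last first.
  exists mrg => [w _|[[x y] z] _]; last by congr (_, _, _); apply/ffunP => i; rewrite !ffunE.
  by apply/ffunP => i; rewrite !ffunE /=; case: (w i) => [[]].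
apply: eq_bigr => w _; congr (_ * _).
  by apply: eq_bigr => i _; rewrite !ffunE.
congr (_%:R); congr (nat_of_bool _); apply/forallP/asboolP => [e|e i].
  by apply/ffunP => i; rewrite [RHS]ffunE !ffunE; have /eqP := e i; rewrite !ffunE.
by have := congr1 (fun c : {ffun 'I_n -> A} => c i) e; rewrite !ffunE => ->.
Qed.

Lemma prob_all_true n (p : bool -> R) :
  prob p (fun w : {ffun 'I_n -> bool} => forall i, w i = true) = p true ^+ n.
Proof.
rewrite /prob (bigD1 [ffun=> true]) //= [X in _ + X]big1 ?addr0 => [|w wT].
  have trueE (i : 'I_n) : [ffun=> true] i = true by rewrite ffunE.
  rewrite asboolT // mulr1 (eq_bigr (fun=> p true)) => [|i _]; last by rewrite trueE.
  by rewrite prodr_const card_ord.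
rewrite asboolF ?mulr0 // => h; case/eqP: wT.
by apply/ffunP => i; rewrite ffunE h.
Qed.

(** By [defect], a power of the success probability is at most the chance that [n] independent
    coordinates all avoid [false], which has positive mass. The exponent [k.+1] is never 0, so a
    root can be taken. *)
Lemma valS_decay : exists (q : R) (k : nat),
  [/\ 0 < q, q < 1 & forall n (s : St n), valS s ^+ k.+1 <= q ^+ n].
Proof.
have [lam [d [vx [vy [vz [lamD lamx lamy lamz lamt]]]]]] := obstruction.
pose D s : Prop := muT s != 0.
have [s0 Ds0] : exists s0, D s0.
  apply: contrapT => nD; have := oner_neq0 R; rewrite -sum_muT big1 ?eqxx // => s _.
  by apply/eqP; apply: contrapT => /negP ms; apply: nD; exists s.
have Dwin : adm valS D (win fS gS hS tT).
  exists muT; split; [exact: muT_ge0|exact: sum_muT| |by exists 1%N].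
  by move=> s Ds; rewrite lt_def Ds muT_ge0.
pose J := (#|Sigma| + #|Gamma| + #|Phi|)%N.
have conn (X V : finType) (x : T -> X) (v : T -> V) : (#|X| <= J)%N ->
    (forall (F : X -> int) (G : V -> int),
       (forall s, D s -> F (x s) + G (v s) = 0) -> forall a b, F a = F b) ->
    forall a b, reach (share D x v) J a b.
  by move=> XJ rig a b; apply: (reach_le rig Ds0 XJ); apply: (reach_card rig Ds0).
have JS : (#|Sigma| <= J)%N by rewrite /J -addnA leq_addr.
have JG : (#|Gamma| <= J)%N by rewrite /J addnAC leq_addl.
have JP : (#|Phi| <= J)%N by rewrite /J leq_addl.
have [] := @defect R St valS valS_01 A Sigma Gamma Phi fS gS hS tT D Dwin J
  _ _ _ _ _ _ s0 Ds0 lam d vx vy vz lamD lamx lamy lamz lamt.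
(* A pair of maps on two letter types, completed by the zero map on the third, is a Z-embedding and
   hence constant. *)
1-6: apply: conn => // F G FG.
- have [|//] := @noZ F G (fun=> 0).
  by move=> x y z m; rewrite addr0; apply: (FG (x, y, z)).
- have [|//] := @noZ F (fun=> 0) G.
  by move=> x y z m; rewrite addr0; apply: (FG (x, y, z)).
- have [|//] := @noZ G F (fun=> 0).
  by move=> x y z m; rewrite addr0 addrC; apply: (FG (x, y, z)).
- have [|//] := @noZ (fun=> 0) F G.
  by move=> x y z m; rewrite add0r; apply: (FG (x, y, z)).
- have [|//] := @noZ G (fun=> 0) F.
  by move=> x y z m; rewrite addr0 addrC; apply: (FG (x, y, z)).
- have [|//] := @noZ (fun=> 0) G F.
  by move=> x y z m; rewrite add0r addrC; apply: (FG (x, y, z)).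
move=> p [p0 p1 pD [k pk]]; have pF := pD false erefl.
move: p1; rewrite big_bool /= => p1.
have pT : p true < 1 by rewrite -p1 ltrDl.
(* The maximum keeps [q] positive even if [p true] is 0. *)
exists (Num.max (p true) 2^-1), k; split.
- by rewrite lt_max invr_gt0 ltr0n orbT.
- by rewrite gt_max pT invf_lt1 ?ltr1n ?ltr0n.
move=> n s; have /andP[v0 v1] := valS_01 s.
apply: (@le_trans _ _ (valS s ^+ k)); first by rewrite exprS ler_piMl ?exprn_ge0.
apply: le_trans (pk n s) _; rewrite prob_all_true.
by apply: lerXn2r; rewrite ?nnegrE ?le_max ?p0 ?lexx.
Qed.

End Game.

Theorem theorem1p4 (R : realType) (Sigma Gamma Phi : finType) (A : finZmodType)
    (mu : Sigma -> Gamma -> Phi -> R) (t : Sigma -> Gamma -> Phi -> A) :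
  is_distr mu ->
  game_val mu t < 1 ->
  no_Z_embeddings mu ->
  exists c : R, 0 < c /\
    forall n : nat, (1 <= n)%N -> game_val_rep mu t n <= 2 `^ (- (c * n%:R)).
Proof.
move=> mu_distr val_lt1 noZ.
have [q [k [q0 q1 qP]]] := valS_decay mu_distr val_lt1 noZ.
have ln2 : 0 < ln 2 :> R by rewrite ln_gt0 // ltr1n.
(* With this [c], the [k.+1]-st power of the claimed bound is exactly [q ^+ n]. *)
exists (- ln q / (k.+1%:R * ln 2)); split.
  by rewrite divr_gt0 ?mulr_gt0 ?oppr_gt0 ?ltr0n // ln_lt0 // q0.
move=> n _; set B := _ `^ _.
have B0 : 0 <= B by apply: powR_ge0.
have BE : B ^+ k.+1 = q ^+ n.
  rewrite /B /powR pnatr_eq0 /= -expRM_natr -[in RHS](lnK q0) -expRM_natr; congr (_ _).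
  by field; rewrite gt_eqF //= nat1r pnatr_eq0.
apply: bigmax_le => // f _; apply: bigmax_le => // g _; apply: bigmax_le => // h _.
rewrite strategy_sum -(@ler_pXn2r _ k.+1) ?nnegrE //; first by rewrite BE; apply: qP.
by case/andP: (valS_01 t mu_distr (f, g, h)).
Qed.
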